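(* Let $n\ge1$ and let $B_1,\dots,B_{n+1}$ be independent standard Brownian motions. Define $\mathcal{I}_n(t)=B_1(|B_2(|B_3(\cdots(|B_{n+1}(t)|)\cdots)|)|)$, $t>0$. Then for $\beta>0$, \begin{align*} \Pr\Big\{\max_{0\le s\le t}\mathcal{I}_n(s)\in d\beta\Big\} =2\int_0^{\infty}\!\!\cdots\!\int_0^{\infty}&\Pr\{B_1(y_1)\in d\beta\}\,\Pr\Big\{\max_{0\le z_1\le y_2}|B_2(z_1)|\in dy_1\Big\}\\ &\times\Pr\Big\{\max_{0\le z_2\le y_3}|B_3(z_2)|\in dy_2\Big\}\cdots\Pr\Big\{\max_{0\le z_n\le t}|B_{n+1}(z_n)|\in dy_n\Big\}. \end{align*}
   Context: $\mathcal{I}_n$ is the $n$-times iterated Brownian motion; the integrals are over $y_1,\dots,y_n\in(0,\infty)$. *)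

(* Defs.v *)
From HB Require Import structures.
From mathcomp Require Import all_boot all_order all_algebra.
From mathcomp Require Import all_classical all_reals all_analysis.
Set Implicit Arguments. Unset Strict Implicit. Unset Printing Implicit Defensive.
Import Order.TTheory GRing.Theory Num.Theory.
Import numFieldNormedType.Exports.
Local Open Scope classical_set_scope.
Local Open Scope ring_scope.

Section BM.
Context {R : realType} {d : measure_display} {T : measurableType d}.
Variable P : probability T R.

(* Standard (one-dimensional) Brownian motion on [0, +oo), time index taken in R
   (values at negative times are irrelevant). *)
Definition std_BM (B : R -> T -> R) : Prop :=
  [/\ (forall s, measurable_fun [set: T] (B s)),
      (forall w, B 0 w = 0),
      (forall w, {within `[0, +oo[, continuous (fun s => B s w)}),
      (forall s u (A : set R), 0 <= s -> s < u -> measurable A ->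
         P [set w | B u w - B s w \in A] = normal_prob 0 (Num.sqrt (u - s)) A) &
      (forall (k : nat) (ts : nat -> R) (A : nat -> set R),
         0 <= ts 0%N -> (forall i, (i < k)%N -> ts i < ts i.+1) ->
         (forall i, measurable (A i)) ->
         P (\bigcap_(i in [set i | (i < k)%N])
              [set w | B (ts i.+1) w - B (ts i) w \in A i]) =
         (\prod_(i < k) P [set w | (B (ts i.+1) w - B (ts i) w)%R \in A i])%E)].

Definition indep_processes (N : nat) (B : nat -> R -> T -> R) : Prop :=
  forall (m : nat) (ts : nat -> nat -> R) (A : nat -> nat -> set R),
    (forall i j, measurable (A i j)) ->
    let E i := \bigcap_(j in [set j | (j < m)%N]) [set w | B i (ts i j) w \in A i j] in
    P (\bigcap_(i in [set i | (1 <= i <= N)%N]) E i) =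
    (\prod_(1 <= i < N.+1) P (E i))%E.

(* ibm B i k s w = B_i(|B_{i+1}(| ... |B_{i+k}(s)| ...|)|); so the n-times
   iterated Brownian motion I_n is ibm B 1 n. *)
Fixpoint ibm (B : nat -> R -> T -> R) (i k : nat) (s : R) (w : T) : R :=
  match k with
  | 0%N => B i s w
  | k'.+1 => B i `|ibm B i.+1 k' s w| w
  end.

Definition max_ibm (B : nat -> R -> T -> R) (n : nat) (t : R) (w : T) : R :=
  sup ((fun s => ibm B 1 n s w) @` `[0, t]).

Definition max_abs (B : nat -> R -> T -> R) (j : nat) (y : R) (w : T) : R :=
  sup ((fun z => `|B j z w|) @` `[0, y]).

(* The iterated integral on the right-hand side, integrated against A (in beta):
   rhs B A 0 y1 = P{B_1(y1) in A};
   rhs B A k y_{k+1} = \int_{(0,oo)} rhs B A (k-1) y_k  P{max_{[0,y_{k+1}]} |B_{k+1}| in dy_k}. *)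
Fixpoint rhs (B : nat -> R -> T -> R) (A : set R) (k : nat) (y : R) : \bar R :=
  match k with
  | 0%N => P [set w | B 1%N y w \in A]
  | k'.+1 => (\int[pushforward P (max_abs B k'.+2 y)]_(x in `]0%R, +oo[) rhs B A k' x)%E
  end.

End BM.

(* Main.v *)
Require Import Defs.
From HB Require Import structures.
From mathcomp Require Import all_boot all_order all_algebra.
From mathcomp Require Import lra.
From mathcomp Require Import all_classical all_reals all_analysis.
From mathcomp Require Import measurable_realfun.

(** Each |J|, with J the process obtained by iterating B_i, ..., B_(n+1), is
    continuous and starts at 0, so by the intermediate value theorem it maps
    [0, t] onto [0, M_i], where M_(n+2) = t and M_i = max_[0, M_(i+1)] |B_i|.
    Hence the maximum of I_n is the maximum of B_1 over [0, M_2].  Since M_(i+1)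
    is a function of B_(i+1), ..., B_(n+1), it is independent of B_i, and
    Fubini's theorem integrates out B_1, B_2, ... one at a time.  The factor 2 is
    the reflection principle P(max_[0, y] B_1 > a) = 2 P(B_1(y) > a), obtained by
    splitting the path, sampled on a finite grid, at its first passage above a
    and reversing the sign of the increment that follows; refining the grid
    removes the overshoot by uniform continuity of the path. *)
Set Implicit Arguments. Unset Strict Implicit. Unset Printing Implicit Defensive.
Import Order.TTheory GRing.Theory Num.Theory.
Import numFieldNormedType.Exports.
Local Open Scope classical_set_scope.
Local Open Scope ring_scope.

Lemma g_sigma_algebra_sub_measurable {d : measure_display}
    {T : measurableType d} (K : set (set T)) :
  K `<=` measurable -> <<s K >> `<=` measurable.
Proof.
by move=> Km; apply: smallest_sub => //; exact: sigma_algebra_measurable.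
Qed.

Lemma measurable_gt_set {R : realType} {d : measure_display}
    {T : measurableType d} (f : T -> R) (c : R) :
  measurable_fun [set: T] f -> measurable [set w | c < f w].
Proof.
move=> mf; rewrite -[X in measurable X]setTI.
rewrite (_ : [set w | _] = f @^-1` `]c, +oo[); first exact: mf.
by apply/seteqP; split => w /=; rewrite in_itv/= andbT.
Qed.

Lemma measurable_le_set {R : realType} {d : measure_display}
    {T : measurableType d} (f : T -> R) (c : R) :
  measurable_fun [set: T] f -> measurable [set w | f w <= c].
Proof.
move=> mf; rewrite -[X in measurable X]setTI.
rewrite (_ : [set w | _] = f @^-1` `]-oo, c]); first exact: mf.
by apply/seteqP; split => w /=; rewrite in_itv.
Qed.

(** * Independence and monotone limits of events *)

Section independence.
Context {R : realType} {d : measure_display} {T : measurableType d}.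
Variable P : probability T R.

Definition indep_events (G H : set (set T)) : Prop :=
  forall E F, G E -> H F -> P (E `&` F) = (P E * P F)%E.

Lemma indep_events_sym (G H : set (set T)) :
  indep_events G H -> indep_events H G.
Proof. by move=> GH E F HE GF; rewrite setIC GH// muleC. Qed.

(** Dynkin's argument: for fixed [F] in [H], the events [E] with [P (E ∩ F) = P E * P F] form a
    lambda-system containing the pi-system [G]. *)
Lemma indep_events_sigmal (G H : set (set T)) :
  G `<=` measurable -> H `<=` measurable -> setI_closed G ->
  indep_events G H -> indep_events <<s G >> H.
Proof.
move=> Gm Hm GI GH E F sE HF; have mF := Hm _ HF.
have sm : <<s G >> `<=` measurable.
  exact: g_sigma_algebra_sub_measurable.
pose L := [set E | measurable E /\ P (E `&` F) = (P E * P F)%E].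
suff : L E by case.
move: E sE; apply: (@lambda_system_subset T G GI setT) => //.
- split.
  + by move=> A _ x _.
  + by split => //; rewrite setTI probability_setT mul1e.
  + move=> A B BA [mA PA] [mB PB]; split; first exact: measurableD.
    have fA : (P A < +oo)%E by rewrite ltey_eq fin_num_measure.
    have fAF : (P (A `&` F) < +oo)%E.
      by rewrite ltey_eq fin_num_measure//; exact: measurableI.
    have -> : (A `\` B) `&` F = (A `&` F) `\` (B `&` F).
      apply/seteqP; split => x /=.
        by move=> [[Ax nBx] Fx]; split => // -[].
      by move=> [[Ax Fx] nBF]; split => //; split => // Bx; apply: nBF.
    rewrite !measureD//; [|exact: measurableI..].
    rewrite (_ : A `&` F `&` (B `&` F) = B `&` F); last first.
      by rewrite setIACA setIid (setIidr BA).
    rewrite (setIidr BA).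
    apply: etrans (congr2 (fun x y => x - y)%E PA PB) _.
    rewrite muleBl ?fin_num_measure//.
    by apply: fin_num_adde_defr; exact: fin_num_measure.
  + move=> F0 nd LF; have mF0 i : measurable (F0 i) by have [] := LF i.
    have mU : measurable (\bigcup_i F0 i) by exact: bigcupT_measurable.
    split => //.
    have c1 : P \o F0 @ \oo --> P (\bigcup_i F0 i).
      exact: nondecreasing_cvg_mu.
    have c2 : P \o (fun i => F0 i `&` F) @ \oo --> P (\bigcup_i (F0 i `&` F)).
      apply: nondecreasing_cvg_mu => //.
      - by move=> i; exact: measurableI.
      - by apply: bigcupT_measurable => i; exact: measurableI.
      - by move=> i j /nd /subsetPset ij; apply/subsetPset; exact: setSI.
    have c3 : (fun i => P (F0 i) * P F)%E @ \oo
        --> (P (\bigcup_i F0 i) * P F)%E.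
      by apply: cvgeZr => //; exact: fin_num_measure.
    rewrite setI_bigcupl.
    apply: (@cvg_unique _ (@ereal_hausdorff R) _ _ _ _ c2).
    rewrite (_ : P \o _ = fun i => P (F0 i) * P F)%E//.
    by apply/funext => i /=; have [] := LF i.
- by move=> A GA; split; [exact: Gm|exact: GH].
Qed.

Lemma indep_events_sigma (G H : set (set T)) :
  G `<=` measurable -> H `<=` measurable -> setI_closed G -> setI_closed H ->
  indep_events G H -> indep_events <<s G >> <<s H >>.
Proof.
move=> Gm Hm GI HI GH.
have sGm : <<s G >> `<=` measurable.
  exact: g_sigma_algebra_sub_measurable.
apply/indep_events_sym/indep_events_sigmal => //.
exact/indep_events_sym/indep_events_sigmal.
Qed.

(** Fatou-type bound: [E] is the increasing union of the events on which every [F k] with [k >= n]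
    holds. It carries grid estimates over to continuous paths, although the rank from which [F n]
    holds depends on the path. *)
Lemma measure_le_eventually (F : (set T)^nat) (E : set T) (c : \bar R) :
  (forall n, measurable (F n)) -> measurable E ->
  (forall w, E w -> \forall n \near \oo, F n w) ->
  (\forall n \near \oo, (P (F n) <= c)%E) -> (P E <= c)%E.
Proof.
move=> mF mE EF [N _ Pc].
pose G n := E `&` \bigcap_(k >= n) F k.
have mG n : measurable (G n).
  by apply: measurableI => //; apply: bigcap_measurable => //; exists n => /=.
have UG : \bigcup_n G n = E.
  apply/seteqP; split => w; first by move=> [n _ []].
  move=> Ew; have [n _ nF] := EF w Ew.
  by exists n => //; split => // k /= nk; exact: nF.
have cG : P \o G @ \oo --> P E.
  rewrite -[X in _ --> P X]UG; apply: nondecreasing_cvg_mu => //.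
    by rewrite UG.
  move=> i j ij; apply/subsetPset => w [Ew iF]; split => // k /= jk.
  by apply: iF => /=; exact: leq_trans jk.
apply: (cvge_to_le cG).
exists N => // n /= Nn; apply: le_trans (Pc n Nn).
by apply: le_measure; rewrite ?inE// => w [_]; apply => /=.
Qed.

End independence.

(** * Running maxima of continuous paths *)

Section running_maximum.
Context {R : realType} {T : Type}.
Implicit Types (X : R -> T -> R) (f : R -> R).

(* At a negative time [y] the image is empty and the junk value is [sup set0 = 0],
   which is also the value at [y = 0] of a path issued from 0. *)
Definition runmax X (y : R) (w : T) : R := sup ((fun z => X z w) @` `[0, y]).

Lemma sup_image0_attained f (y : R) : 0 <= y ->
  {within `[0, +oo[, continuous f} ->
  exists c, [/\ 0 <= c <= y, sup (f @` `[0, y]) = f c &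
    forall z, 0 <= z <= y -> f z <= f c].
Proof.
move=> y0 cf.
have cf' : {within `[0, y], continuous f}.
  apply: continuous_subspaceW cf => z /=.
  by rewrite !in_itv/= => /andP[->].
have [c c0y cmax] := EVT_max y0 cf'.
exists c; split; first by move: c0y; rewrite in_itv.
  apply/eqP; rewrite eq_le; apply/andP; split.
    apply: ge_sup; first by exists (f c), c.
    by move=> _ [z z0y <-]; exact: cmax.
  apply: ub_le_sup; last by exists c.
  by exists (f c) => _ [z z0y <-]; exact: cmax.
by move=> z z0y; apply: cmax; rewrite in_itv.
Qed.

Lemma sup_image0_ge0 f (y : R) : f 0 = 0 ->
  {within `[0, +oo[, continuous f} -> 0 <= sup (f @` `[0, y]).
Proof.
move=> f0 cf; have [y0|y0] := leP 0 y.
  have [c [_ -> +]] := sup_image0_attained y0 cf.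
  by move=> /(_ 0); rewrite f0; apply; rewrite lexx.
by rewrite set_itv_ge ?bnd_simp -?ltNge// image_set0 sup0.
Qed.

(** The intermediate value theorem between 0 and a point where [|f|] is maximal. An interval issued
    from 0 is sent to another one, so the argument can be iterated. *)
Lemma image_norm_itv f (y : R) : 0 <= y -> f 0 = 0 ->
  {within `[0, +oo[, continuous f} ->
  (fun z => `|f z|) @` `[0, y] = `[0, sup ((fun z => `|f z|) @` `[0, y])]%classic.
Proof.
move=> y0 f0 cf.
have cnf : {within `[0, +oo[, continuous (fun z => `|f z|)}.
  by move=> x; apply: continuous_comp; [exact: cf|exact: norm_continuous].
have [c [/andP[c0 cy] supE cmax]] := sup_image0_attained y0 cnf.
rewrite supE; apply/seteqP; split => [_ [z z0y <-] /=|v /=].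
  by rewrite in_itv/= normr_ge0/=; apply: cmax; move: z0y; rewrite /= in_itv.
rewrite in_itv/= => /andP[v0 vc].
have cnf' : {within `[0, c], continuous (fun z => `|f z|)}.
  apply: continuous_subspaceW cnf => z /=.
  by rewrite !in_itv/= => /andP[->].
have [|z + zv] := IVT (v := v) c0 cnf'.
  by rewrite f0 normr0 min_l ?max_r// v0.
rewrite in_itv/= => /andP[z0 zc].
by exists z => //=; rewrite in_itv/= z0 (le_trans zc cy).
Qed.

(* A countable description of the running maximum, whence its joint
   measurability in time and path. *)
Lemma sup_image0_gt f (y a : R) : 0 <= a -> f 0 = 0 ->
  {within `[0, +oo[, continuous f} ->
  a < sup (f @` `[0, y]) <->
  exists q : rat, [/\ 0 <= ratr q :> R, ratr q <= y & a < f (ratr q)].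
Proof.
move=> a0 f0 cf; split; last first.
  move=> [q [q0 qy afq]]; apply: lt_le_trans afq _.
  have [c [_ -> cmax]] := sup_image0_attained (le_trans q0 qy) cf.
  by apply: cmax; rewrite q0.
have [y0|y0] := leP 0 y; last first.
  by rewrite set_itv_ge ?bnd_simp -?ltNge// image_set0 sup0 ltNge a0.
have [c [/andP[c0 cy] -> cmax]] := sup_image0_attained y0 cf.
move=> ac.
(* The rational is sought to the left of the maximiser [c], so that it stays below [y]; this
   requires [c] to be positive. *)
have c_gt0 : 0 < c.
  rewrite lt_neqAle c0 andbT; apply/eqP => c0'; move: ac.
  by rewrite -c0' f0 ltNge a0.
have cfc : {within `[0, c], continuous f}.
  apply: continuous_subspaceW cf => z /=.
  by rewrite !in_itv/= => /andP[->].
have [_ _ cl] := (continuous_within_itvP f c_gt0).1 cfc.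
have nr := cvgr_gt _ cl _ ac.
have : \forall x \near c^'-, 0 < x /\ a < f x.
  by near do split; [exact: nbhs_left_gt|exact: nr].
rewrite near_withinE => /nbhs_ballP[e /= e0 be].
have [q] : exists q : rat, (ratr q : R) \in `]c - e, c[.
  by apply: rat_in_itvoo; rewrite ltrBlDr ltrDl.
rewrite in_itv/= => /andP[ceq qc].
have [] := be (ratr q) _ qc.
  by rewrite /ball/= ltr_norml; apply/andP; split; lra.
move=> q0 afq; exists q; split => //; first exact: ltW.
by rewrite (le_trans (ltW qc)).
Unshelve. all: end_near. Qed.

End running_maximum.

(** * Iterated maxima of the moduli *)

Section iterated_maximum.
Context {R : realType} {d : measure_display} {T : measurableType d}.
Variables (B : nat -> R -> T -> R) (t : R).

(* [iter_max i k] is the maximum over [0, t] of the modulus of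
   [ibm B i k.-1]. *)
Fixpoint iter_max (i k : nat) (w : T) : R :=
  if k is k'.+1 then max_abs B i (iter_max i.+1 k' w) w else t.

Variable w : T.
Let cpath i := B i 0 w = 0 /\ {within `[0, +oo[, continuous (fun s => B i s w)}.

Lemma iter_max_ge0 i k : 0 <= t ->
  (forall j, (i <= j < i + k)%N -> cpath j) -> 0 <= iter_max i k w.
Proof.
move=> t0; case: k => [//|k] cB /=.
have [B0 cBi] : cpath i by apply: cB; rewrite leqnn addnS ltnS leq_addr.
apply: (@sup_image0_ge0 _ (fun z => `|B i z w|)); first by rewrite B0 normr0.
by move=> x; apply: continuous_comp; [exact: cBi|exact: norm_continuous].
Qed.

Lemma image_norm_ibm i k : 0 <= t ->
  (forall j, (i <= j <= i + k)%N -> cpath j) ->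
  (fun s => `|ibm B i k s w|) @` `[0, t] = `[0, iter_max i k.+1 w]%classic.
Proof.
move=> t0; elim: k i => [|k IH] i cB.
  have [B0 cBi] : cpath i by apply: cB; rewrite leqnn leq_addr.
  exact: (@image_norm_itv _ (fun z => B i z w)).
have [B0 cBi] : cpath i by apply: cB; rewrite leqnn leq_addr.
have cB' j : (i.+1 <= j <= i.+1 + k)%N -> cpath j.
  by move=> /andP[ij jk]; apply: cB; rewrite (ltnW ij) -addSnnS.
rewrite -[LHS](image_comp (fun s => `|ibm B i.+1 k s w|) (fun z => `|B i z w|)).
rewrite IH//; apply: (@image_norm_itv _ (fun z => B i z w)) => //.
by apply: iter_max_ge0 => // j; rewrite addnS ltnS; exact: cB'.
Qed.

(** The outermost [B 1] carries no modulus, so the description of the image by an interval stops at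
    index 2. *)
Lemma max_ibmE n : 0 <= t -> (forall j, (1 <= j <= n.+1)%N -> cpath j) ->
  max_ibm B n t w = runmax (B 1%N) (iter_max 2 n w) w.
Proof.
case: n => [//|n] t0 cB; rewrite /max_ibm /runmax; congr sup.
rewrite -(@image_norm_ibm 2 n t0) ?image_comp//.
by move=> j /andP[j2 jn]; apply: cB; rewrite (ltnW j2).
Qed.

End iterated_maximum.

(** Joint measurability is what permits evaluation at a random time. For [a >= 0] the superlevel set
    is a countable union of rectangles indexed by nonnegative rationals; for [a < 0] it is
    everything. *)
Lemma measurable_runmax {R : realType} {d : measure_display}
    {T : measurableType d} (X : R -> T -> R) :
  (forall s, measurable_fun [set: T] (X s)) -> (forall w, X 0 w = 0) ->
  (forall w, {within `[0, +oo[, continuous (fun s => X s w)}) ->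
  measurable_fun [set: R * T] (fun p => runmax X p.1 p.2).
Proof.
move=> mX X0 cX _.
apply: (measurability _ (RGenOInfty.measurableE R)) => // _ [_ [a ->] <-].
rewrite setTI.
have [a0|a0] := ltP a 0.
  rewrite (_ : _ @^-1` _ = setT)//; apply/seteqP; split => // -[y w] _ /=.
  rewrite in_itv/= andbT (lt_le_trans a0)//.
  exact: (@sup_image0_ge0 _ (fun z => X z w)).
rewrite (_ : _ @^-1` _ = \bigcup_(q in [set q : rat | 0 <= ratr q :> R])
   (`[ratr q, +oo[ `*` [set w | a < X (ratr q) w])); last first.
  apply/seteqP; split => [[y w] /=|[y w] [q /= q0 []]/=].
    rewrite in_itv/= andbT.
    move=> /(sup_image0_gt y a0 (X0 w) (cX w))[q [q0 qy aX]].
    by exists q => //=; split => //=; rewrite in_itv/= qy.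
  rewrite !in_itv/= !andbT => qy aX.
  by apply/(sup_image0_gt y a0 (X0 w) (cX w)); exists q.
rewrite bigcup_mkcond; apply: bigcupT_measurable_rat => q; case: ifP => // _.
apply: measurableX => //; rewrite -[X in measurable X]setTI.
rewrite (_ : [set w | _] = X (ratr q) @^-1` `]a, +oo[); first exact: mX.
by apply/seteqP; split => w /=; rewrite in_itv/= andbT.
Qed.

(** * Cylinder sigma-algebras of the independent processes *)

Section cylinders.
Context {R : realType} {d : measure_display} {T : measurableType d}.
Variables (B : nat -> R -> T -> R) (N : nat).
Hypothesis mB : forall i s, (1 <= i <= N)%N -> measurable_fun [set: T] (B i s).
Implicit Types (m : nat) (ts : nat -> nat -> R) (A : nat -> nat -> set R).

Definition box m ts A i : set T :=
  \bigcap_(j in [set j | (j < m)%N]) [set w | B i (ts i j) w \in A i j].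

(* Finite-dimensional events about the processes [B i], [i \in I]: coordinates
   outside [I] are left unconstrained. *)
Definition cyl (I : set nat) : set (set T) :=
  [set E | exists m ts A, [/\ forall i j, measurable (A i j),
     forall i j, ~ I i -> A i j = setT &
     E = \bigcap_(i in [set i | (1 <= i <= N)%N]) box m ts A i]].

(** Merges two lists of times, or of constraints, so that the intersection of two boxes is again a
    box. *)
Definition concat {U : Type} m (f g : nat -> nat -> U) i j : U :=
  if (j < m)%N then f i j else g i (j - m)%N.

Lemma box_concat m m' ts ts' A A' i :
  box (m + m') (concat m ts ts') (concat m A A') i =
  box m ts A i `&` box m' ts' A' i.
Proof.
apply/seteqP; split => [w h|w [h h'] j /= jm].
  split => j /= jm.
    by have := h j; rewrite /concat /= jm; apply; rewrite ltn_addr.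
  have := h (m + j)%N; rewrite /concat /= (ltnNge _ m) leq_addr/= addKn; apply.
  by rewrite ltn_add2l.
rewrite /concat; case: ltnP => jm'; first exact: h.
by apply: h' => /=; rewrite ltn_subLR.
Qed.

Lemma box_setT m ts A i : (forall j, A i j = setT) -> box m ts A i = setT.
Proof.
by move=> AT; apply/seteqP; split => // w _ j _ /=; rewrite AT in_setT.
Qed.

Lemma measurable_box m ts A i : (1 <= i <= N)%N ->
  (forall j, measurable (A i j)) -> measurable (box m ts A i).
Proof.
move=> iN mA; apply: bigcap_measurableType => j _.
rewrite -[X in measurable X]setTI.
rewrite (_ : [set w | _] = B i (ts i j) @^-1` A i j); first exact: mB.
by apply/seteqP; split => w /=; rewrite inE.
Qed.

Lemma cyl_measurable I : cyl I `<=` measurable.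
Proof.
move=> _ [m [ts [A [mA _ ->]]]]; apply: bigcap_measurableType => i iN.
exact: measurable_box.
Qed.

Lemma bigcap_box_concat m m' ts ts' A A' :
  \bigcap_(i in [set i | (1 <= i <= N)%N])
    box (m + m') (concat m ts ts') (concat m A A') i =
  \bigcap_(i in [set i | (1 <= i <= N)%N]) box m ts A i `&`
  \bigcap_(i in [set i | (1 <= i <= N)%N]) box m' ts' A' i.
Proof. by rewrite -bigcapI; apply: eq_bigcapr => i _; exact: box_concat. Qed.

Lemma cyl_setI_closed I : setI_closed (cyl I).
Proof.
move=> _ _ [m [ts [A [mA AT ->]]]] [m' [ts' [A' [mA' AT' ->]]]].
exists (m + m')%N, (concat m ts ts'), (concat m A A'); split.
- by move=> i j; rewrite /concat; case: ifP.
- by move=> i j nI; rewrite /concat; case: ifP => _; [exact: AT|exact: AT'].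
- by rewrite bigcap_box_concat.
Qed.

Lemma measurable_cyl_coord (I : set nat) i s : I i -> (1 <= i <= N)%N ->
  measurable_fun [set: g_sigma_algebraType (cyl I)] (B i s).
Proof.
move=> Ii iN _ A mA; rewrite setTI; apply: sub_sigma_algebra.
exists 1%N, (fun _ _ => s), (fun l _ => if l == i then A else setT).
split.
- by move=> l _; case: ifP.
- by move=> l _ nI; case: eqP => // li; rewrite li in nI.
- apply/seteqP; split => [w Aw l _ j _ /=|w /(_ i iN 0%N)/=].
    by case: eqP => [->|_]; rewrite ?in_setT// inE.
  by rewrite eqxx inE; exact.
Qed.

Variable P : probability T R.
Hypothesis indepB : indep_processes P N B.

(** For each process at least one of the two boxes is the whole space, so independence of the
    processes factors the probability index by index. *)
Lemma cyl_indep I J : (forall i, I i -> ~ J i) ->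
  indep_events P (cyl I) (cyl J).
Proof.
move=> IJ _ _ [m [ts [A [mA AT ->]]]] [m' [ts' [A' [mA' AT' ->]]]].
rewrite -bigcap_box_concat.
have mAA i j : measurable (concat m A A' i j).
  by rewrite /concat; case: ifP.
have := indepB (m + m') (concat m ts ts') mAA.
rewrite -/(box _ _ _) => ->; rewrite indepB// indepB//.
rewrite -big_split/=; apply: eq_big_nat => i iN.
rewrite -/(box _ _ _ _) -/(box _ _ _ _) -/(box _ _ _ _) box_concat.
have [Ii|nIi] := pselect (I i).
  rewrite (@box_setT m' ts' A'); last by move=> j; exact/AT'/IJ.
  by rewrite setIT probability_setT mule1.
rewrite (@box_setT m ts A); last by move=> j; exact: AT.
by rewrite setTI probability_setT mul1e.
Qed.

End cylinders.

Section iter_max_measurable.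
Context {R : realType} {d : measure_display} {T : measurableType d}.
Variables (P : probability T R) (B : nat -> R -> T -> R) (N : nat) (t : R).
Hypothesis BM : forall i, (1 <= i <= N)%N -> std_BM P (B i).

Lemma measurable_max_abs d' (T' : measurableType d') (X : R -> T' -> R) :
  (forall s, measurable_fun [set: T'] (X s)) -> (forall w, X 0 w = 0) ->
  (forall w, {within `[0, +oo[, continuous (fun s => X s w)}) ->
  measurable_fun [set: R * T'] (fun p => runmax (fun z w => `|X z w|) p.1 p.2).
Proof.
move=> mX X0 cX; apply: measurable_runmax => [s|w|w].
- by apply: measurableT_comp => //; exact: normr_measurable.
- by rewrite X0 normr0.
- by move=> x; apply: continuous_comp; [exact: cX|exact: norm_continuous].
Qed.

(** Measurability with respect to the cylinders of [I], and not merely on [T], is what later yields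
    independence from the processes outside [I]. *)
Lemma measurable_iter_max (I : set nat) i k :
  (forall l, (i <= l < i + k)%N -> I l) -> (1 <= i)%N -> (i + k <= N.+1)%N ->
  measurable_fun [set: g_sigma_algebraType (cyl B N I)] (iter_max B t i k).
Proof.
elim: k i => [|k IH] i Isub i1 ikN; first exact: measurable_cst.
have iN : (1 <= i <= N)%N.
  by rewrite i1 -ltnS; apply: leq_trans ikN; rewrite addnS ltnS leq_addr.
have [_ B0 cB _ _] := BM iN.
have Ii : I i by apply: Isub; rewrite leqnn addnS ltnS leq_addr.
have mm := @measurable_max_abs _ (g_sigma_algebraType (cyl B N I)) (B i)
  (fun s => measurable_cyl_coord s Ii iN) B0 cB.
have mp : measurable_fun [set: g_sigma_algebraType (cyl B N I)]
    (fun w : g_sigma_algebraType (cyl B N I) => (iter_max B t i.+1 k w, w)).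
  apply: measurable_fun_pair => //.
  apply: IH => //; last by rewrite addSnnS.
  by move=> l /andP[il lk]; apply: Isub; rewrite (ltnW il) -addSnnS.
exact: (measurableT_comp mm mp).
Qed.

End iter_max_measurable.

(** * Fubini's theorem for independent sigma-algebras *)

Section independent_fubini.
Context {R : realType} {d : measure_display} {T : measurableType d}.
Variables (P : probability T R) (G H : set (set T)).
Hypotheses (Gm : G `<=` measurable) (Hm : H `<=` measurable).
Local Notation TG := (g_sigma_algebraType G).

(** The identity seen as a random variable valued in [T] with the smaller sigma-algebra; its law
    [PG] is the restriction of [P] to [<<s G >>]. *)
Let idG : T -> TG := id.
Let mid : measurable_fun setT idG.
Proof.
by move=> _ A sA; rewrite setTI; exact: (g_sigma_algebra_sub_measurable Gm).
Qed.
HB.instance Definition _ := isMeasurableFun.Build _ _ _ _ idG mid.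
Let PG := distribution P idG.

Variable f : R * TG -> \bar R.
Hypotheses (mf : measurable_fun [set: R * TG] f) (f0 : forall p, (0 <= f p)%E).

Let fubini_FE y : fubini_F PG f y = (\int[P]_w f (y, w))%E.
Proof.
rewrite /fubini_F /PG /distribution ge0_integral_pushforward//.
by apply: (measurableT_comp mf); exact: measurable_fun_pair.
Qed.

Lemma measurable_integral_section :
  measurable_fun [set: R] (fun y => \int[P]_w f (y, w))%E.
Proof.
rewrite (_ : (fun _ => _) = fubini_F PG f); last first.
  by apply/funext => y; rewrite fubini_FE.
exact: measurable_fun_fubini_tonelli_F.
Qed.

Hypothesis GH : indep_events P <<s G >> <<s H >>.
Variable M : T -> R.
Hypothesis mM : measurable_fun [set: g_sigma_algebraType H] M.

(** By independence the joint law of [M] and [idG] is the product of their laws; Tonelli's theorem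
    then separates the two variables. *)
Lemma integral_indep :
  (\int[P]_w f (M w, w) = \int[P]_w \int[P]_v f (M w, v))%E.
Proof.
have mM' : measurable_fun [set: T] M.
  move=> _ A mA; apply: (g_sigma_algebra_sub_measurable Hm).
  exact: (mM measurableT mA).
pose Mm := isMeasurableFun.Build _ _ _ _ M mM'.
pose Mp : {mfun T >-> R} := HB.pack M Mm.
have mpair : measurable_fun [set: T] (fun w => (M w, idG w)).
  by apply: measurable_fun_pair.
pose pairm := isMeasurableFun.Build _ _ _ _ _ mpair.
pose pairp : {mfun T >-> (R * TG)%type} := HB.pack (fun w => (M w, idG w)) pairm.
transitivity (\int[distribution P pairp]_p f p)%E.
  by rewrite /distribution ge0_integral_pushforward.
transitivity (\int[distribution P Mp \x PG]_p f p)%E.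
  (* A product measure is determined by its values on rectangles, where the claim is the
     independence [GH]. *)
  apply: eq_measure_integral => A mA _; apply/esym.
  apply: product_measure_unique => // C D mC mD.
  rewrite /distribution /pushforward /PG/= muleC -GH//; last first.
    rewrite -[X in _ X]setTI; exact: (mM measurableT mC).
  by congr (P _); apply/seteqP; split => w [].
rewrite fubini_tonelli1// /distribution ge0_integral_pushforward//=; last 2 first.
- exact: measurable_fun_fubini_tonelli_F.
- by move=> y _; apply: integral_ge0.
by apply: eq_integral => w _; rewrite /= fubini_FE.
Qed.

End independent_fubini.

(** * The reflection principle *)

Section normal_symmetry.
Context {R : realType}.

(** The centred density is even, so the substitution of [- x] for [x] exchanges the half-lines;
    closing them at 0 does not change the integrals. *)
Lemma normal_prob_symmetric (s : R) : s != 0 ->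
  normal_prob 0 s `]0, +oo[ = normal_prob 0 s `]-oo, 0[.
Proof.
move=> s0; rewrite /normal_prob.
pose f x : \bar R := (normal_pdf 0 s x)%:E.
have mf : measurable_fun [set: R] f.
  by apply/measurable_EFinP; exact: measurable_normal_pdf.
have fN x : f (- x) = f x by rewrite /f !normal_pdfE// /normal_fun !subr0 sqrrN.
rewrite (@integral_itv_obnd_cbnd _ _ _ f); last exact: measurable_funS mf.
rewrite (@integral_itv_bndo_bndc _ _ _ f); last exact: measurable_funS mf.
rewrite (@ge0_integration_by_substitution0 _ f)//; last first.
  by move=> x; rewrite lee_fin normal_pdf_ge0.
by under eq_integral do rewrite fN.
Qed.

End normal_symmetry.

(** * Independence and symmetry of the increments *)

Section increments.
Context {R : realType} {d : measure_display} {T : measurableType d}.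
Variables (P : probability T R) (B : R -> T -> R).
Hypothesis BM : std_BM P B.

Lemma measurable_incr s u (A : set R) : measurable A ->
  measurable [set w | B u w - B s w \in A].
Proof.
move=> mA; have [mB _ _ _ _] := BM.
rewrite -[X in measurable X]setTI.
rewrite (_ : [set w | _] = (B u \- B s) @^-1` A); last first.
  by apply/seteqP; split => w /=; rewrite inE.
by apply: measurable_funB.
Qed.

Definition incr_cyl (ts : nat -> R) (k : nat) : set (set T) :=
  [set E | exists2 A : nat -> set R, forall i, measurable (A i) &
    E = \bigcap_(i in [set i | (i < k)%N])
          [set w | B (ts i.+1) w - B (ts i) w \in A i]].

Lemma incr_cyl_measurable ts k : incr_cyl ts k `<=` measurable.
Proof.
move=> _ [A mA ->]; apply: bigcap_measurableType => i _.
exact: measurable_incr.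
Qed.

Lemma incr_cyl_setI_closed ts k : setI_closed (incr_cyl ts k).
Proof.
move=> _ _ [A mA ->] [A' mA' ->]; exists (fun i => A i `&` A' i).
  by move=> i; exact: measurableI.
rewrite -bigcapI; apply: eq_bigcapr => i _.
by apply/seteqP; split => w /=; rewrite !inE.
Qed.

Lemma incr_indep ts k u : 0 <= ts 0%N ->
  (forall i, (i < k)%N -> ts i < ts i.+1) -> ts k < u ->
  indep_events P <<s incr_cyl ts k >>
    [set E | exists2 C, measurable C & E = [set w | B u w - B (ts k) w \in C]].
Proof.
move=> t0 tlt tu; have [_ _ _ _ BI] := BM.
apply: indep_events_sigmal.
- exact: incr_cyl_measurable.
- by move=> _ [C mC ->]; exact: measurable_incr.
- exact: incr_cyl_setI_closed.
move=> _ _ [A mA ->] [C mC ->].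
(* The time [u] is appended to the grid and [C] to the constraints; independence of the [k.+1]
   increments then isolates the last factor. *)
pose ts' i := if (i <= k)%N then ts i else u.
pose A' i := if (i < k)%N then A i else C.
have ts'k i : (i < k)%N -> (ts' i = ts i) * (ts' i.+1 = ts i.+1).
  by move=> ik; rewrite /ts' ik (ltnW ik).
have ts'S : (ts' k = ts k) * (ts' k.+1 = u).
  by rewrite /ts' leqnn ltnn.
have := BI k.+1 ts' A'.
rewrite big_ord_recr/= !ts'S.
have -> : \bigcap_(i in [set i | (i < k.+1)%N])
      [set w | B (ts' i.+1) w - B (ts' i) w \in A' i] =
    \bigcap_(i in [set i | (i < k)%N])
      [set w | B (ts i.+1) w - B (ts i) w \in A i] `&`
    [set w | B u w - B (ts k) w \in C].
  apply/seteqP; split => [w h|w [h hk] i /=].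
    split; last by have := h k (leqnn _); rewrite /= !ts'S /A' ltnn.
    move=> i /= ik; have := h i (ltnW ik : (i < k.+1)%N).
    by rewrite /= !(ts'k i ik) /A' ik.
  rewrite ltnS leq_eqVlt => /orP[/eqP ->|ik].
    by rewrite !ts'S /A' ltnn.
  by rewrite !(ts'k i ik) /A' ik; exact: h.
move=> ->; last 3 first.
- by rewrite /ts' leq0n.
- move=> i; rewrite ltnS leq_eqVlt => /orP[/eqP ->|ik].
    by rewrite !ts'S.
  by rewrite !(ts'k i ik) tlt.
- by move=> i; rewrite /A'; case: ifP.
rewrite BI// /A' ltnn; congr (_ * _)%E; apply: eq_bigr => i _.
by rewrite !(ts'k i (ltn_ord i)) ltn_ord.
Qed.

Lemma measurable_incr_cyl_coord ts k i : ts 0%N = 0 -> (i <= k)%N ->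
  measurable_fun [set: g_sigma_algebraType (incr_cyl ts k)] (B (ts i)).
Proof.
have [_ B0 _ _ _] := BM.
move=> t0; elim: i => [_|i IH ik].
  rewrite t0 (_ : B 0 = cst 0); first exact: measurable_cst.
  by apply/funext => w; rewrite B0.
have -> : B (ts i.+1) = B (ts i) \+ (fun w => B (ts i.+1) w - B (ts i) w).
  by apply/funext => w /=; rewrite addrC subrK.
apply: measurable_funD; first exact: IH (ltnW ik).
move=> _ A mA; rewrite setTI; apply: sub_sigma_algebra.
exists (fun j => if j == i then A else setT).
  by move=> j; case: ifP.
apply/seteqP; split => [w Aw j _ /=|w /(_ i ik)/=].
  by case: eqP => [->|_]; rewrite ?in_setT// inE.
by rewrite eqxx inE.
Qed.

(** The increment after [ts k] is independent of the past and has a symmetric law: this is the sign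
    reversal behind the reflection principle. *)
Lemma incr_symmetric ts k u E : 0 <= ts 0%N ->
  (forall i, (i < k)%N -> ts i < ts i.+1) -> ts k < u ->
  <<s incr_cyl ts k >> E ->
  P (E `&` [set w | B (ts k) w < B u w]) =
  P (E `&` [set w | B u w < B (ts k) w]).
Proof.
move=> t0 tlt tu sE; have [_ _ _ BN _] := BM.
have tk0 : 0 <= ts k.
  elim: k tlt {tu sE} => [//|k IH] tlt.
  apply: (@le_trans _ _ (ts k)); last by rewrite ltW// tlt.
  by apply: IH => i ik; exact: tlt (ltnW ik).
have -> : [set w | B (ts k) w < B u w] =
    [set w | B u w - B (ts k) w \in `]0, +oo[%classic].
  by apply/seteqP; split => w /=; rewrite inE/= in_itv/= andbT subr_gt0.
have -> : [set w | B u w < B (ts k) w] =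
    [set w | B u w - B (ts k) w \in `]-oo, 0[%classic].
  by apply/seteqP; split => w /=; rewrite inE/= in_itv/= subr_lt0.
rewrite !(incr_indep t0 tlt tu sE); last 2 first.
- by exists `]-oo, 0[%classic.
- by exists `]0, +oo[%classic.
rewrite !BN// normal_prob_symmetric//.
by rewrite gt_eqF// sqrtr_gt0 subr_gt0.
Qed.

End increments.

(** * Reflection along a finite grid *)

Section discrete_reflection.
Context {R : realType} {d : measure_display} {T : measurableType d}.
Variables (P : probability T R) (B : R -> T -> R).
Hypothesis BM : std_BM P B.
Variables (ts : nat -> R) (n : nat) (a : R).
Hypotheses (ts0 : ts 0%N = 0) (tslt : forall i, (i < n)%N -> ts i < ts i.+1).
Hypothesis a0 : 0 <= a.

Definition above k : set T := [set w | a < B (ts k) w].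
Definition grid_above : set T := \big[setU/set0]_(k < n.+1) above k.
Definition first_above : nat -> set T := seqDU above.
Definition big_jump (e : R) : set T :=
  \big[setU/set0]_(k < n) [set w | e < B (ts k.+1) w - B (ts k) w].

Let mB : forall s, measurable_fun [set: T] (B s). Proof. by case: BM. Qed.
Let B0 w : B 0 w = 0. Proof. by case: BM. Qed.

Let mgt s c : measurable [set w | c < B s w].
Proof. exact: measurable_gt_set. Qed.

Let mle s c : measurable [set w | B s w <= c].
Proof. exact: measurable_le_set. Qed.

Let mlt s u : measurable [set w | B s w < B u w].
Proof.
rewrite (_ : [set w | _] = [set w | B u w - B s w \in `]0, +oo[%classic]).
  exact: (measurable_incr BM).
by apply/seteqP; split => w /=; rewrite inE/= in_itv/= andbT subr_gt0.
Qed.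

Lemma measurable_grid_above : measurable grid_above.
Proof. by apply: bigsetU_measurable => k _; exact: mgt. Qed.

Lemma measurable_big_jump e : measurable (big_jump e).
Proof.
apply: bigsetU_measurable => k _.
rewrite (_ : [set w | _] =
   [set w | B (ts k.+1) w - B (ts k) w \in `]e, +oo[%classic]).
  exact: (measurable_incr BM).
by apply/seteqP; split => w /=; rewrite inE/= in_itv/= andbT.
Qed.

Lemma sigma_first_above k : <<s incr_cyl B ts k >> (first_above k).
Proof.
have mab j : (j <= k)%N ->
    measurable (above j : set (g_sigma_algebraType (incr_cyl B ts k))).
  move=> jk; apply: (@measurable_gt_set _ _ (g_sigma_algebraType _) (B (ts j))).
  exact: (measurable_incr_cyl_coord BM).
(* Membership in the generated sigma-algebra is read as measurability, which gives access to the
   closure lemmas. *)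
rewrite -[X in X _]/(@measurable _ (g_sigma_algebraType (incr_cyl B ts k))).
apply: measurableD; first exact: mab.
by apply: bigsetU_measurable => j _; apply: mab; exact: ltnW.
Qed.

Let mfirst k : measurable (first_above k).
Proof.
apply: measurableD; first exact: mgt.
by apply: bigsetU_measurable => j _; exact: mgt.
Qed.

Lemma measure_grid_above_setI C : measurable C ->
  P (grid_above `&` C) = (\sum_(k < n.+1) P (first_above k `&` C))%E.
Proof.
move=> mC; rewrite /grid_above bigsetU_seqDU.
rewrite (big_distrl C)/=; rewrite -/(first_above).
rewrite (@measure_bigsetU _ _ _ P (fun k => first_above k `&` C))//.
- by move=> k; exact: measurableI.
- exact/trivIset_setIr/trivIset_seqDU.
Qed.

Let first_below k j w : first_above k w -> (j < k)%N -> B (ts j) w <= a.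
Proof.
move=> [_ nU] jk; rewrite leNgt; apply/negP => aj; apply: nU.
by rewrite -bigcup_mkord; exists j.
Qed.

Let first_ge k w : first_above k w -> a < B (ts k) w.
Proof. by case. Qed.

Let ts_lt j k : (j < k)%N -> (k <= n)%N -> ts j < ts k.
Proof.
elim: k => [//|k IH]; rewrite ltnS leq_eqVlt => /orP[/eqP-> kn|jk kn].
  exact: tslt.
by apply: lt_trans (tslt kn); apply: IH => //; exact: ltnW.
Qed.

(** After a first passage at [k], ending at or below [a] forces a descent below [B (ts k)]; the
    reversed path ends above [B (ts k)], hence above [a]. So ending at or below [a] is at most as
    likely as ending above it. *)
Lemma grid_reflection_le :
  (P grid_above <= 2%:E * P [set w | (a < B (ts n) w)%R])%E.
Proof.
have mg := measurable_grid_above.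
rewrite (measureDI P mg (mgt (ts n) a)).
rewrite (_ : grid_above `\` [set w | a < B (ts n) w] =
    grid_above `&` [set w | B (ts n) w <= a]); last first.
  rewrite setDE; congr (_ `&` _).
  by apply/seteqP; split => w /=; rewrite leNgt => /negP.
have le1 : (P (grid_above `&` [set w | (B (ts n) w <= a)%R]) <=
    P (grid_above `&` [set w | (a < B (ts n) w)%R]))%E.
  rewrite !measure_grid_above_setI//; apply: lee_sum => -[k /= kn] _.
  have [kn'|nk] := ltnP k n; last first.
    have -> : k = n by apply/eqP; rewrite eqn_leq nk -ltnS kn.
    rewrite (_ : _ `&` _ = set0) ?measure0//.
    by apply/seteqP; split => // w [/first_ge] /=; rewrite ltNge => /negP.
  apply: (@le_trans _ _
      (P (first_above k `&` [set w | (B (ts n) w < B (ts k) w)%R]))).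
    apply: le_measure; rewrite ?inE; [exact: measurableI..|].
    by move=> w [fk /= le]; split => //=; exact: le_lt_trans (first_ge fk).
  rewrite -(incr_symmetric BM)//; last 4 first.
  - by rewrite ts0.
  - by move=> i ik; apply: tslt; exact: ltn_trans kn'.
  - exact: ts_lt.
  - exact: sigma_first_above.
  apply: le_measure; rewrite ?inE; [exact: measurableI..|].
  by move=> w [fk /= le]; split => //=; exact: lt_trans (first_ge fk) le.
have le2 : (P (grid_above `&` [set w | (a < B (ts n) w)%R]) <=
    P [set w | (a < B (ts n) w)%R])%E by exact: measureIr.
rewrite mule_natl mule2n; apply: leeD => //; exact: le_trans le2.
Qed.

(* The grid may overshoot [a] at its first passage; on the complement of
   [big_jump e] the overshoot is at most [e]. *)
Lemma grid_reflection_ge e : 0 < e ->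
  (2%:E * P [set w | (a + e < B (ts n) w)%R] <=
   P grid_above + P (big_jump e))%E.
Proof.
move=> e0; have mg := measurable_grid_above.
have mj := measurable_big_jump e.
rewrite (measureDI P mg (mgt (ts n) (a + e))).
rewrite (_ : grid_above `\` [set w | a + e < B (ts n) w] =
    grid_above `&` [set w | B (ts n) w <= a + e]); last first.
  rewrite setDE; congr (_ `&` _).
  by apply/seteqP; split => w /=; rewrite leNgt => /negP.
have gE : grid_above `&` [set w | a + e < B (ts n) w] =
    [set w | a + e < B (ts n) w].
  apply/setIidr => w /= h; rewrite /grid_above -bigcup_mkord; exists n => //=.
  by rewrite /above /= (lt_trans _ h)// ltrDl.
have : (P (grid_above `&` [set w | (a + e < B (ts n) w)%R]) <=
    P (grid_above `&` big_jump e) +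
    P (grid_above `&` [set w | (B (ts n) w <= a + e)%R]))%E.
  rewrite !measure_grid_above_setI// -big_split/=.
  apply: lee_sum => -[k /= kn] _.
  (* Passage at [k] with overshoot at most [e]; this depends only on the path up to [ts k], as the
     reversal requires. *)
  pose U := first_above k `&` [set w | B (ts k) w <= a + e].
  have sU : <<s incr_cyl B ts k >> U.
    rewrite -[X in X _]/(@measurable _ (g_sigma_algebraType (incr_cyl B ts k))).
    apply: measurableI; first exact: sigma_first_above.
    apply: (@measurable_le_set _ _ (g_sigma_algebraType _) (B (ts k))).
    exact: (measurable_incr_cyl_coord BM).
  have mU : measurable U by exact: measurableI.
  apply: (@le_trans _ _ (P ((first_above k `&` big_jump e) `|`
      (U `&` [set w | (a + e < B (ts n) w)%R])))).
    apply: le_measure; rewrite ?inE; first exact: measurableI.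
      by apply: measurableU; exact: measurableI.
    move=> w [fk /= gt].
    have [le|gtk] := leP (B (ts k) w) (a + e); [right|left]; split => //.
    (* At [k = 0] the path is at 0 and cannot overshoot; otherwise the preceding node lies at or
       below [a], so the last increment exceeds [e]. *)
    case: k kn fk gtk @U sU mU => [|k] kn fk gtk _ _ _.
      by move: gtk; rewrite ts0 B0 ltNge addr_ge0// ltW.
    rewrite /big_jump -(bigcup_mkord n
      (fun k => [set w | e < B (ts k.+1) w - B (ts k) w])); exists k => //=.
    by have := first_below fk (leqnn k.+1); lra.
  apply: le_trans (measureU2 _ _ _) _; [exact: measurableI..|].
  apply: leeD => //.
  have [kn'|nk] := ltnP k n; last first.
    have kE : k = n by apply/eqP; rewrite eqn_leq nk -ltnS kn.
    rewrite (_ : U `&` _ = set0) ?measure0//.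
    apply/seteqP; split => // w [[_ /=]].
    by rewrite kE leNgt => /negP.
  apply: (@le_trans _ _ (P (U `&` [set w | (B (ts k) w < B (ts n) w)%R]))).
    apply: le_measure; rewrite ?inE; [exact: measurableI..|].
    by move=> w [[fk /= le] gt]; split => //=; exact: le_lt_trans gt.
  rewrite (incr_symmetric BM)//; last 3 first.
  - by rewrite ts0.
  - by move=> i ik; apply: tslt; exact: ltn_trans kn'.
  - exact: ts_lt.
  apply: le_measure; rewrite ?inE; [exact: measurableI..|].
  move=> w [[fk /= le] gt]; split => //=.
  exact: le_trans (ltW gt) le.
rewrite gE => h; rewrite mule_natl mule2n.
apply: le_trans (leeD h (lexx _)) _.
rewrite -addeA [leRHS]addeC; apply: leeD => //.
by apply: measureIr.
Qed.

End discrete_reflection.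

(** * Uniform grids and continuity of the path *)

Section uniform_grid.
Context {R : realType}.
Implicit Types (f : R -> R) (y : R).

Definition grid y (N k : nat) : R := y * k%:R / N.+1%:R.

Lemma grid_last y N : grid y N N.+1 = y.
Proof. by rewrite /grid mulfK// pnatr_eq0. Qed.

Lemma gridS y N k : grid y N k.+1 = grid y N k + y / N.+1%:R.
Proof. by rewrite /grid -natr1 mulrDr mulr1 mulrDl. Qed.

Lemma mesh_near y (e : R) : 0 < y -> 0 < e ->
  \forall N \near \oo, y / N.+1%:R < e.
Proof.
move=> y0 e0; have ey : 0 < e / y by rewrite divr_gt0.
near=> N; rewrite mulrC -ltr_pdivlMr//; near: N.
exact: (near_infty_natSinv_lt (PosNum ey)).
Unshelve. all: end_near. Qed.

Lemma within_continuous_ball f y x (e : R) : 0 <= x <= y -> 0 < e ->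
  {within `[0, +oo[, continuous f} ->
  exists2 r : R, 0 < r &
    forall z, 0 <= z <= y -> `|x - z| < r -> `|f x - f z| < e.
Proof.
move=> xy e0 cf.
have cf' : {within `[0, y], continuous f}.
  apply: continuous_subspaceW cf => z /=.
  by rewrite !in_itv/= => /andP[->].
have Kx : `[0, y]%classic x by rewrite /= in_itv.
have := (subspace_continuousP _ f).1 cf' x Kx.
move=> /cvgrPdist_lt /(_ e e0).
rewrite near_withinE => /nbhs_ballP[r /= r0 br].
by exists r => // z zy zr; apply: br => //; rewrite /= in_itv.
Qed.

(** Uniform continuity on the compact [[0, y]], in the near-covering form of compactness: a local
    statement about [Q] becomes uniform in [x]. *)
Lemma grid_increments_small f y (e : R) : 0 < y -> 0 < e ->
  {within `[0, +oo[, continuous f} ->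
  \forall N \near \oo, forall k, (k < N.+1)%N ->
    f (grid y N k.+1) - f (grid y N k) <= e.
Proof.
move=> y0 e0 cf.
pose Q (N : nat) x := forall z, 0 <= z <= y -> `|x - z| <= y / N.+1%:R ->
  f z - f x <= e.
have : \forall N \near \oo, `[0, y]%classic `<=` Q N.
  have /compact_near_coveringP/near_covering_withinP := @segment_compact R 0 y.
  apply => x /=; rewrite in_itv/= => xy.
  have e2 : 0 < e / 2 by rewrite divr_gt0.
  have [r r0 hr] := within_continuous_ball xy e2 cf.
  have r2 : 0 < r / 2 by rewrite divr_gt0.
  (* Half of [r] bounds the distance from [x] to [x'], the other half the mesh, so that [z] stays
     within [r] of [x]. *)
  exists (ball x (r / 2), [set N | y / N.+1%:R < r / 2]).
    by split => /=; [exact: nbhsx_ballx|exact: mesh_near].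
  move=> [x' N] [/= bx' mN]; rewrite in_itv/= => x'y z zy x'z.
  have h1 : `|f x - f x'| < e / 2.
    by apply: hr => //; rewrite (lt_trans bx')// ltr_pdivrMr//; lra.
  have h2 : `|f x - f z| < e / 2.
    apply: hr => //; rewrite -(subrK x' x) -addrA.
    apply: le_lt_trans (ler_normD _ _) _.
    by have := ltrD bx' (le_lt_trans x'z mN); rewrite /ball/=; lra.
  by move: h1 h2; rewrite !ltr_norml => /andP[? ?] /andP[? ?]; lra.
apply: filterS => N KQ k kN.
have N0 : 0 < N.+1%:R :> R by rewrite ltr0n.
have gk j : (j <= N.+1)%N -> 0 <= grid y N j <= y.
  move=> jN; rewrite /grid divr_ge0 ?mulr_ge0 ?(ltW y0)//=.
  by rewrite ler_pdivrMr// ler_pM2l// ler_nat.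
apply: (KQ (grid y N k)).
- by rewrite /= in_itv/= gk// ltnW.
- exact: gk.
- rewrite gridS opprD addrA subrr sub0r normrN ger0_norm//.
  by rewrite divr_ge0 ?(ltW y0).
Qed.

(** The path exceeds [a] at some rational, hence by continuity also at the nearest node to its left
    once the mesh is small. *)
Lemma grid_reaches f y a : 0 < y -> 0 <= a -> f 0 = 0 ->
  {within `[0, +oo[, continuous f} -> a < sup (f @` `[0, y]) ->
  \forall N \near \oo, exists2 k, (k < N.+2)%N & a < f (grid y N k).
Proof.
move=> y0 a0 f0 cf /(sup_image0_gt _ a0 f0 cf)[q [q0 qy aq]].
have fa0 : 0 < f (ratr q) - a by rewrite subr_gt0.
have qy' : 0 <= (ratr q : R) <= y by apply/andP.
have [r r0 hr] := within_continuous_ball qy' fa0 cf.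
near=> N.
have N0 : 0 < N.+1%:R :> R by rewrite ltr0n.
have mN : y / N.+1%:R < r by near: N; exact: mesh_near.
set x : R := ratr q in q0 qy aq fa0 qy' hr *.
have xN0 : 0 <= x * N.+1%:R / y.
  by apply: divr_ge0; [exact: mulr_ge0|exact: ltW].
have /andP[tl tu] := truncn_itv xN0.
(* [k] is the index of the last node not exceeding [x]. *)
set k := Num.trunc _ in tl tu.
have gx : grid y N k <= x.
  by rewrite /grid ler_pdivrMr// mulrC -ler_pdivlMr.
have xg : x < grid y N k.+1.
  by rewrite /grid ltr_pdivlMr// (mulrC y) -ltr_pdivrMr.
have kN : (k < N.+2)%N.
  have : (k%:R : R) <= N.+1%:R.
    apply: le_trans tl _; rewrite ler_pdivrMr// mulrC ler_pM2l//.
  by rewrite ler_nat.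
exists k => //.
have g0 : 0 <= grid y N k.
  by apply: divr_ge0 => //; apply: mulr_ge0 => //; exact: ltW.
have : `|f x - f (grid y N k)| < f x - a.
  apply: hr; first by rewrite g0 (le_trans gx).
  rewrite ger0_norm ?subr_ge0//; move: xg mN; rewrite gridS.
  by move: (grid y N k) (y / N.+1%:R) => g h; lra.
by rewrite ltr_norml => /andP[_]; lra.
Unshelve. all: end_near. Qed.

End uniform_grid.

(** * Reflection in continuous time *)

Section reflection.
Context {R : realType} {d : measure_display} {T : measurableType d}.
Variables (P : probability T R) (B : R -> T -> R).
Hypothesis BM : std_BM P B.

Let mgt s c : measurable [set w | c < B s w].
Proof. by apply: measurable_gt_set; case: BM. Qed.

Lemma measurable_runmax_at y : measurable_fun [set: T] (runmax B y).
Proof.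
have [mB B0 cB _ _] := BM.
have := measurableT_comp (measurable_runmax mB B0 cB)
  (measurable_fun_pair (measurable_cst y) (@measurable_id _ T setT)).
exact.
Qed.

Let mmax y c : measurable [set w | c < runmax B y w].
Proof. exact/measurable_gt_set/measurable_runmax_at. Qed.

Let grid_lt (y : R) N i : 0 < y -> grid y N i < grid y N i.+1.
Proof. by move=> y0; rewrite gridS ltrDl divr_gt0. Qed.

Let grid0 (y : R) N : grid y N 0 = 0 :> R.
Proof. by rewrite /grid mulr0 mul0r. Qed.

Lemma reflection_le y a : 0 < y -> 0 <= a ->
  (P [set w | (a < runmax B y w)%R] <= 2%:E * P [set w | (a < B y w)%R])%E.
Proof.
move=> y0 a0; have [_ B0 cB _ _] := BM.
apply: (@measure_le_eventually _ _ _ P (fun N => grid_above B (grid y N) N.+1 a)).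
- by move=> N; exact: (measurable_grid_above BM).
- exact: mmax.
- move=> w aw; have := grid_reaches y0 a0 (B0 w) (cB w) aw.
  apply: filterS => N [k kN ak].
  by rewrite /grid_above -bigcup_mkord; exists k.
- apply: nearW => N; rewrite -[in leRHS](grid_last y N).
  by apply: grid_reflection_le => // i _; exact: grid_lt.
Qed.

Let reflection_ge_eps y a e : 0 < y -> 0 <= a -> 0 < e ->
  (2%:E * P [set w | (a + e < B y w)%R] <= P [set w | (a < runmax B y w)%R])%E.
Proof.
move=> y0 a0 e0; have [_ B0 cB _ _] := BM.
set p := P [set w | _]; set q := P [set w | _].
have pE : p = (fine p)%:E by rewrite fineK// fin_num_measure.
have qE : q = (fine q)%:E by rewrite fineK// fin_num_measure.
have mj N := measurable_big_jump BM (grid y N) N.+1 e.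
(* The vanishing of the probability of a big jump is used through complements: every path eventually
   avoids [big_jump], and each complement has probability at most [1 + q - 2p] by the grid
   estimate. *)
suff : (P setT <= (1 + fine q - 2 * fine p)%:E)%E.
  by rewrite probability_setT pE qE -EFinM !lee_fin; lra.
apply: (@measure_le_eventually _ _ _ P
  (fun N => ~` big_jump B (grid y N) N.+1 e)) => //.
- by move=> N; exact: measurableC.
- move=> w _; have := grid_increments_small y0 e0 (cB w).
  apply: filterS => N small.
  rewrite /big_jump -(bigcup_mkord N.+1
     (fun k => [set w | e < B (grid y N k.+1) w - B (grid y N k) w])).
  by move=> [k /= kN]; rewrite ltNge small.
- apply: nearW => N; rewrite probability_setC//.
  have := @grid_reflection_ge _ _ _ P B BM (grid y N) N.+1 a (grid0 y N)
    (fun i _ => grid_lt N i y0) a0 e e0.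
  rewrite grid_last -/p => h.
  have hq : (P (grid_above B (grid y N) N.+1 a) <= q)%E.
    apply: le_measure; rewrite ?inE; [exact: (measurable_grid_above BM)|exact: mmax|].
    move=> w; rewrite /grid_above -bigcup_mkord => -[k /= kN ak].
    have gky : 0 <= grid y N k <= y.
      rewrite /grid divr_ge0 ?mulr_ge0 ?(ltW y0)//=.
      by rewrite ler_pdivrMr// ler_pM2l// ler_nat.
    have [c [_ supE cmax]] := sup_image0_attained (ltW y0) (cB w).
    by rewrite /= /runmax supE (lt_le_trans ak)// cmax.
  have := le_trans h (leeD hq (lexx _)).
  set J := P (big_jump _ _ _ _).
  have -> : J = (fine J)%:E by rewrite fineK// fin_num_measure.
  by rewrite pE qE -EFinM -EFinD -EFinB !lee_fin; lra.
Qed.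

Lemma reflection_tail y a : 0 < y -> 0 <= a ->
  (P [set w | (a < runmax B y w)%R] = 2%:E * P [set w | (a < B y w)%R])%E.
Proof.
move=> y0 a0; apply/eqP; rewrite eq_le reflection_le//=.
set p := P [set w | _]; set q := P [set w | _].
have pE : p = (fine p)%:E by rewrite fineK// fin_num_measure.
have qE : q = (fine q)%:E by rewrite fineK// fin_num_measure.
suff : (p <= (fine q / 2)%:E)%E.
  by rewrite pE qE -EFinM !lee_fin; lra.
(* The margin [e] is removed along [e = 1 / n.+1], since [a < B y w] leaves room for all small
   [e]. *)
apply: (@measure_le_eventually _ _ _ P
  (fun n => [set w | a + n.+1%:R^-1 < B y w])) => //.
- move=> w /= aw; have ba : 0 < B y w - a by rewrite subr_gt0.
  have := near_infty_natSinv_lt (PosNum ba).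
  by apply: filterS => n /=; rewrite ltrBrDl.
- apply: nearW => n; have n0 : 0 < n.+1%:R^-1 :> R by rewrite invr_gt0.
  have := reflection_ge_eps y0 a0 n0; rewrite -/q.
  set r := P [set w | _].
  have -> : r = (fine r)%:E by rewrite fineK// fin_num_measure.
  by rewrite qE -EFinM !lee_fin; lra.
Qed.

(** Both sides are finite measures once restricted to the positive half-line; they agree on the
    half-lines []u, +oo[], a generating pi-system. *)
Lemma reflection_principle y (A : set R) : 0 < y -> measurable A ->
  A `<=` `]0, +oo[ ->
  (P [set w | runmax B y w \in A] = 2%:E * P [set w | B y w \in A])%E.
Proof.
move=> y0 mA A0; have [mB _ _ _ _] := BM.
have mM := measurable_runmax_at y.
pose Mm := isMeasurableFun.Build _ _ _ _ (runmax B y) mM.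
pose Mp : {mfun T >-> R} := HB.pack (runmax B y) Mm.
pose Bm := isMeasurableFun.Build _ _ _ _ (B y) (mB y).
pose Bp : {mfun T >-> R} := HB.pack (B y) Bm.
have mD : measurable (`]0, +oo[ : set R) by exact: measurable_itv.
pose m1 : {measure set R -> \bar R} := mrestr (distribution P Mp) mD.
pose m2 : {measure set R -> \bar R} :=
  mscale (NngNum (ler0n R 2)) (mrestr (distribution P Bp) mD).
have m1E C : m1 C = P [set w | runmax B y w \in C `&` `]0, +oo[].
  by congr (P _); apply/seteqP; split => w /=; rewrite inE.
have m2E C : m2 C = (2%:E * P [set w | B y w \in C `&` `]0%R, +oo[])%E.
  by congr (_ * P _)%E; apply/seteqP; split => w /=; rewrite inE.
rewrite -(setIidl A0) -m1E -m2E.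
apply: (measure_unique (@RGenOInfty.G R) (fun n => `]- n%:R, +oo[%classic)) => //.
- exact: RGenOInfty.measurableE.
- move=> _ _ [u ->] [v ->]; exists (Num.max u v).
  by apply/seteqP; split => x /=; rewrite !in_itv/= !andbT gt_max; [move=> []->|move/andP].
- by move=> n; exists (- n%:R).
- apply/seteqP; split => // x _; exists (Num.trunc `|x|).+1 => //=.
  rewrite in_itv/= andbT ltrNl; apply: le_lt_trans (truncnS_gt _).
  by rewrite -normrN ler_norm.
- move=> _ [u ->]; rewrite m1E m2E.
  (* The restriction replaces [u] by a nonnegative level, to which [reflection_tail] applies. *)
  have -> : `]u, +oo[ `&` `]0, +oo[ = `]Num.max u 0, +oo[%classic.
    by apply/seteqP; split => x /=; rewrite !in_itv/= !andbT gt_max; [move=> []->|move/andP].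
  have tail (X : T -> R) : [set w | X w \in `]Num.max u 0, +oo[%classic] =
      [set w | Num.max u 0 < X w].
    by apply/seteqP; split => w /=; rewrite inE/= in_itv/= andbT.
  by rewrite !tail reflection_tail// le_max lexx orbT.
- move=> n; rewrite m1E; apply: le_lt_trans (probability_le1 _ _) (ltry 1).
  rewrite (_ : [set w | _] =
      runmax B y @^-1` (`]- n%:R, +oo[ `&` `]0, +oo[)); last first.
    by apply/seteqP; split => w /=; rewrite inE.
  by rewrite -[X in measurable X]setTI; apply: measurable_runmax_at => //;
    exact: measurableI.
Qed.

End reflection.

(** * Integrating out the processes *)

Section main_induction.
Context {R : realType} {d : measure_display} {T : measurableType d}.
Variables (P : probability T R) (n : nat) (B : nat -> R -> T -> R) (t : R).
Hypothesis BM : forall i, (1 <= i <= n.+1)%N -> std_BM P (B i).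
Hypothesis indepB : indep_processes P n.+1 B.
Variable A : set R.
Hypotheses (mA : measurable A) (A0 : A `<=` `]0, +oo[).

Local Notation TG i := (g_sigma_algebraType (cyl B n.+1 [set i])).

Let mB i s : (1 <= i <= n.+1)%N -> measurable_fun [set: T] (B i s).
Proof. by move=> /BM[]. Qed.

Section one_step.
Variables (i j : nat) (X : R -> T -> R) (h : R -> \bar R).
Hypotheses (i1 : (1 <= i)%N) (ij : (i + j <= n.+1)%N).
Hypothesis mX : measurable_fun [set: R * TG i] (fun p => X p.1 p.2).
Hypotheses (mh : measurable_fun [set: R] h) (h0 : forall x, (0 <= h x)%E).

Let mf : measurable_fun [set: R * TG i] (fun p => h (X p.1 p.2)).
Proof. exact: (measurableT_comp mh mX). Qed.

Lemma measurable_integral_path :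
  measurable_fun [set: R] (fun y => \int[P]_w h (X y w))%E.
Proof.
have := @measurable_integral_section _ _ _ P _
  (cyl_measurable mB (I := [set i])) _ mf (fun p => h0 _).
exact.
Qed.

(** [X] depends on the process [i] alone, the random time only on processes of larger index; the two
    cylinder sigma-algebras are independent. *)
Lemma integral_path_indep :
  (\int[P]_w h (X (iter_max B t i.+1 j w) w) =
   \int[P]_w \int[P]_v h (X (iter_max B t i.+1 j w) v))%E.
Proof.
pose J := [set l | (i < l)%N].
apply: (@integral_indep _ _ _ P _ (cyl B n.+1 J) (cyl_measurable mB (I := [set i]))
  (cyl_measurable mB (I := J)) _ mf (fun p => h0 _)).
- apply: indep_events_sigma; [exact: cyl_measurable..
    |exact: cyl_setI_closed|exact: cyl_setI_closed|].
  by apply: (cyl_indep indepB) => l /= ->; rewrite /J/= ltnn.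
- apply: (measurable_iter_max t BM) => //.
  by move=> l /andP[].
Qed.

End one_step.

(* Same recursion as [rhs], with the law of the maximum of [B 1] at its bottom and
   the integrals pulled back to [T]. *)
Fixpoint max_prob (k : nat) (y : R) : \bar R :=
  if k is k'.+1 then (\int[P]_w max_prob k' (max_abs B k'.+2 y w))%E
  else P [set w | runmax (B 1%N) y w \in A].

Lemma max_prob_ge0 k y : (0 <= max_prob k y)%E.
Proof.
elim: k y => [|k IH] y /=; first exact: measure_ge0.
by apply: integral_ge0 => w _; exact: IH.
Qed.

Let h0 (x : R) : \bar R := (\1_A x)%:E.

Let mh0 : measurable_fun [set: R] h0.
Proof. exact/measurable_EFinP/measurable_indic. Qed.

Let h0_ge0 x : (0 <= h0 x)%E. Proof. by rewrite lee_fin. Qed.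

Let mrunmax1 : measurable_fun [set: R * TG 1] (fun p => runmax (B 1%N) p.1 p.2).
Proof.
have [_ B0 cB _ _] := BM (isT : (1 <= 1 <= n.+1)%N).
apply: measurable_runmax => // s.
exact: (@measurable_cyl_coord _ _ _ _ _ [set 1%N]).
Qed.

Let mmax_abs k : (k < n)%N ->
  measurable_fun [set: R * TG k.+2] (fun p => max_abs B k.+2 p.1 p.2).
Proof.
move=> kn; have kn2 : (1 <= k.+2 <= n.+1)%N by [].
have [_ B0 cB _ _] := BM kn2.
apply: (@measurable_max_abs _ _ (TG k.+2) (B k.+2)) => // s.
exact: (@measurable_cyl_coord _ _ _ _ _ [set k.+2]).
Qed.

Let mrunmax1T : measurable_fun [set: R * T] (fun p => runmax (B 1%N) p.1 p.2).
Proof.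
have [mB1 B0 cB _ _] := BM (isT : (1 <= 1 <= n.+1)%N).
exact: measurable_runmax.
Qed.

Let max_prob0 y : max_prob 0 y = (\int[P]_w h0 (runmax (B 1%N) y w))%E.
Proof.
rewrite /= /h0.
have mM : measurable_fun [set: T] (runmax (B 1%N) y).
  exact: (measurable_runmax_at (BM (isT : (1 <= 1 <= n.+1)%N))).
rewrite (_ : [set w | _] = runmax (B 1%N) y @^-1` A); last first.
  by apply/seteqP; split => w /=; rewrite inE.
rewrite -[X in P X]setIT -integral_indic//.
by rewrite -[X in measurable X]setTI; exact: mM.
Qed.

Lemma measurable_max_prob k : (k <= n)%N -> measurable_fun [set: R] (max_prob k).
Proof.
elim: k => [_|k IH kn].
  rewrite (_ : max_prob 0 = fun y => \int[P]_w h0 (runmax (B 1%N) y w))%E.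
    exact: (@measurable_integral_path 1%N).
  by apply/funext => y; exact: max_prob0.
apply: (@measurable_integral_path k.+2) => //; first exact: mmax_abs.
  exact: IH (ltnW kn).
by move=> x; exact: max_prob_ge0.
Qed.

(** Induction on [j], the number of maxima still nested in the random time. Each step integrates out
    [B k.+2], turning [max_prob k] into [max_prob k.+1]; at [j = 0] the time is the constant [t]. *)
Lemma integral_max_prob k j : (k + j)%N = n ->
  (\int[P]_w max_prob k (iter_max B t k.+2 j w) = max_prob n t)%E.
Proof.
elim: j k => [|j IH] k.
  rewrite addn0 => -> /=; rewrite integral_cst//.
  by rewrite [X in (_ * X)%E](probability_setT P) mule1.
move=> kj; have kn : (k < n)%N by rewrite -kj addnS ltnS leq_addr.
rewrite /= (@integral_path_indep k.+2 j _ (max_prob k))//.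
- by rewrite -(IH k.+1)// -kj addSnnS.
- by rewrite -kj !addSn addnS.
- exact: mmax_abs.
- exact: measurable_max_prob (ltnW kn).
- by move=> x; exact: max_prob_ge0.
Qed.

(** All the maxima involved are then 0, which is not in [A]. Thus the restriction to []0, +oo[] of
    the integrals in [rhs] loses nothing. *)
Lemma max_prob_le0 k y : (k <= n)%N -> y <= 0 -> max_prob k y = 0%E.
Proof.
have sup0' (f : R -> R) z : z <= 0 -> f 0 = 0 -> sup (f @` `[0, z]) = 0.
  rewrite le_eqVlt => /orP[/eqP ->|z0] f0.
    by rewrite set_itv1 image_set1 f0 sup1.
  by rewrite set_itv_ge ?bnd_simp -?ltNge// image_set0 sup0.
elim: k y => [|k IH] y kn y0 /=.
  have [_ B0 _ _ _] := BM (isT : (1 <= 1 <= n.+1)%N).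
  rewrite (_ : [set w | _] = set0) ?measure0//.
  apply/seteqP; split => // w /=; rewrite /runmax sup0'// inE.
  by move=> /A0; rewrite /= in_itv/= ltxx.
have kn2 : (1 <= k.+2 <= n.+1)%N by [].
have [_ B0 _ _ _] := BM kn2.
apply: integral0_eq => w _.
rewrite /max_abs (@sup0' (fun z => `|B k.+2 z w|))//; last by rewrite B0 normr0.
by apply: IH => //; exact: ltnW.
Qed.

(** The reflection principle enters only at the base, where it gives the factor [1 / 2]; linearity
    carries this factor through the integrals. *)
Lemma rhsE k y : (k <= n)%N -> 0 < y ->
  rhs P B A k y = (2^-1%:E * max_prob k y)%E.
Proof.
elim: k y => [|k IH] y kn y0 /=.
  rewrite (reflection_principle (BM (isT : (1 <= 1 <= n.+1)%N)) y0 mA A0).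
  by rewrite muleA -EFinM mulVf// mul1e.
have kn2 : (1 <= k.+2 <= n.+1)%N by [].
have [mBk B0 cB _ _] := BM kn2.
have mM : measurable_fun [set: T] (max_abs B k.+2 y).
  exact: (measurableT_comp (measurable_max_abs mBk B0 cB)
    (measurable_fun_pair (measurable_cst y) (@measurable_id _ T setT))).
have mp := measurable_max_prob (ltnW kn).
rewrite ge0_integral_pushforward//; last 2 first.
- apply: (eq_measurable_fun (fun x => 2^-1%:E * max_prob k x)%E).
    by move=> x; rewrite inE/= in_itv/= andbT => x0; rewrite IH// ltnW.
  by apply: measurable_funTS; exact: measurable_funeM.
- move=> x; rewrite inE/= in_itv/= andbT => x0.
  by rewrite IH ?(ltnW kn)// mule_ge0 ?lee_fin ?invr_ge0// max_prob_ge0.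
rewrite -ge0_integralZl//; last 2 first.
- exact: (measurableT_comp mp mM).
- by move=> w _; exact: max_prob_ge0.
(* On paths where the maximum is not positive, the restricted integrand is 0 and so is
   [max_prob]. *)
rewrite integral_mkcond; apply: eq_integral => w _.
rewrite patchE; case: ifPn; rewrite ?inE/= ?notin_setE/= in_itv/= andbT.
  by move=> x0; rewrite IH// ltnW.
by move=> /negP; rewrite -leNgt => x0; rewrite max_prob_le0 ?mule0// ltnW.
Qed.

Lemma prob_max_ibm : 0 <= t ->
  P [set w | max_ibm B n t w \in A] = max_prob n t.
Proof.
move=> t0.
have mI : measurable_fun [set: T] (iter_max B t 2 n).
  move=> _ C mC; apply: (g_sigma_algebra_sub_measurable (cyl_measurable mB (I := setT))).
  have := @measurable_iter_max _ _ _ P B n.+1 t BM setT 2 n.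
  by apply.
have mM : measurable_fun [set: T] (fun w => runmax (B 1%N) (iter_max B t 2 n w) w).
  have mp : measurable_fun [set: T] (fun w => (iter_max B t 2 n w, w)).
    exact: measurable_fun_pair.
  exact: (measurableT_comp mrunmax1T mp).
rewrite (_ : [set w | _] =
    (fun w => runmax (B 1%N) (iter_max B t 2 n w) w) @^-1` A); last first.
  apply/seteqP; split => w /=; rewrite inE max_ibmE// => j jn.
    by have [_ B0 cB _ _] := BM jn.
  by have [_ B0 cB _ _] := BM jn.
transitivity (\int[P]_w h0 (runmax (B 1%N) (iter_max B t 2 n w) w))%E.
  rewrite -[X in P X]setIT -integral_indic//.
  by rewrite -[X in measurable X]setTI; exact: mM.
rewrite (@integral_path_indep 1%N n)//.
rewrite -(@integral_max_prob 0 n)//.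
by apply: eq_integral => w _; rewrite max_prob0.
Qed.

End main_induction.

Theorem theorem3p1 (R : realType) (d : measure_display) (T : measurableType d)
    (P : probability T R) (n : nat) (B : nat -> R -> T -> R) (t : R) :
  (1 <= n)%N -> 0 < t ->
  (forall i, (1 <= i <= n.+1)%N -> std_BM P (B i)) ->
  indep_processes P n.+1 B ->
  forall A : set R, measurable A -> A `<=` `]0, +oo[ ->
  P [set w | max_ibm B n t w \in A] = (2%:E * rhs P B A n t)%E.
Proof.
move=> _ t0 BM indepB A mA A0.
rewrite (prob_max_ibm BM indepB)// ?ltW// (rhsE BM)//.
by rewrite muleA -EFinM mulfV// mul1e.
Qed.
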